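(* For all $0\le k\le n$, the generalised Koornwinder polynomials satisfy $$xH_{n,k}^{(a,b,c,d)}(x,y)=\sum_{m=n-1}^{n+1}l_{m,k}^{\,x,(n,k)}\,H_{m,k}^{(a,b,c,d)}(x,y),$$ where $$l_{m,k}^{\,x,(n,k)}=\left(J(w_R^{(a,b,c+d+2k+1)})\right)_{[n-k,m-k]},\qquad n-1\le m\le n+1.$$ Therefore the matrix $J_x^{(a,b,c,d)}$, defined by $x\,\mathbf H^{(a,b,c,d)}=\mathbf H^{(a,b,c,d)}J_x^{(a,b,c,d)}$, is symmetric and block-tridiagonal (it has block-bandwidths $(1,1)$) with diagonal blocks (each block has bandwidths $(0,0)$).
   Context: Setting. Let $\alpha<\beta$ and $\gamma<\delta$ be real, and let $\rho$ be a function on $[\alpha,\beta]$, positive on $(\alpha,\beta)$, with either: case (i), $\rho$ is a polynomial of degree $d_0$; or case (ii), $\rho$ is the square root of a polynomial of degree $d_1=\deg\rho^2$ and $\delta=-\gamma>0$. Put $\eta=0$ in case (i), $\eta=1$ in case (ii), so $d_\eta=\deg\rho^{1+\eta}$; assume $d_\eta\ge 2+\eta$. Let $\Omega=\{(x,y):\alpha\le x\le\beta,\ \gamma\rho(x)\le y\le\delta\rho(x)\}$. The parameters $a,b,c,d>-1$ are real, with $c=d$ in case (ii), and such that the weights below are integrable. Polynomials. $w_R^{(a,b,s)}(x)=(\beta-x)^a(x-\alpha)^b\rho(x)^s$ on $[\alpha,\beta]$, and $R_n^{(a,b,s)}$ ($n\ge0$) are the orthonormal polynomials (degree $n$, positive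 leading coefficient) for this weight. $w_P^{(d,c)}(y)=(\delta-y)^d(y-\gamma)^c$ on $[\gamma,\delta]$, with orthonormal polynomials $\widetilde P_n^{(d,c)}$. The generalised Koornwinder polynomials are $$H_{n,k}^{(a,b,c,d)}(x,y)=R_{n-k}^{(a,b,c+d+2k+1)}(x)\,\rho(x)^k\,\widetilde P_k^{(d,c)}(y/\rho(x)),\quad 0\le k\le n,$$ orthonormal on $\Omega$ with respect to $W^{(a,b,c,d)}(x,y)=(\beta-x)^a(x-\alpha)^b(y-\gamma\rho(x))^c(\delta\rho(x)-y)^d$. $\mathbf H^{(a,b,c,d)}$ is the infinite row vector of all $H_{n,k}^{(a,b,c,d)}$, ordered in blocks $n=0,1,2,\dots$, block $n$ being $(H_{n,0},\dots,H_{n,n})$. $J(w_R^{(a,b,s)})$ is the (symmetric tridiagonal) Jacobi matrix defined by $x\,\mathbf R^{(a,b,s)}=\mathbf R^{(a,b,s)}J(w_R^{(a,b,s)})$, $\mathbf R^{(a,b,s)}=(R_0^{(a,b,s)},R_1^{(a,b,s)},\dots)$. Conventions. $A_{[i,j]}$ is the entry in row $i+1$, column $j+1$ of $A$, and is $0$ if $i<0$ or $j<0$. Terms $H_{m,k}$ with indices outside $0\le k\le m$ are omitted (zero). A matrix has bandwidths $(\sigma,\mu)$ if $A_{[i,j]}=0$ whenever $i-j>\sigma$ or $j-i>\mu$; block-bandwidths are defined in the same way, with block $(i,j)$ (of size $(i+1)\times(j+1)$) in place of entry $[i,j]$, and ''each block has bandwidths'' refers to bandwidths within the blocks. *)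

(* Defs.v *)
From HB Require Import structures.
From mathcomp Require Import all_boot all_order all_algebra.
From mathcomp Require Import all_classical all_reals all_analysis.

Set Implicit Arguments.
Unset Strict Implicit.
Unset Printing Implicit Defensive.

Import Order.TTheory GRing.Theory Num.Theory.
Import numFieldNormedType.Exports.

Local Open Scope classical_set_scope.
Local Open Scope ring_scope.

(* Infinite matrices are indexed from 0, so that A i j is A_[i,j]. *)
Definition infmatrix (R : Type) := nat -> nat -> R.

(* f V = V A on D, for an infinite row vector V of functions. The product V A
   is purely algebraic: every column of A has finitely many nonzero entries. *)
Definition mul_matrix (R : realType) (T : Type) (D : set T) (f : T -> R)
    (V : nat -> T -> R) (A : infmatrix R) : Prop :=
  forall j, exists N : nat,
    (forall i, (N <= i)%N -> A i j = 0) /\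
    (forall t, D t -> f t * V j t = \sum_(i < N) V i t * A i j).

Definition symmetric_matrix (R : Type) (A : infmatrix R) : Prop :=
  forall i j, A i j = A j i.

Definition bandwidths (R : realType) (m n : nat) (s u : nat)
    (A : 'M[R]_(m, n)) : Prop :=
  forall (i : 'I_m) (j : 'I_n), (s < i - j)%N \/ (u < j - i)%N -> A i j = 0.

(* Ordering in blocks: block n holds the pairs (n, 0), ..., (n, n), and
   therefore starts at position n (n + 1) / 2. *)
Definition block_pos (n k : nat) : nat := 'C(n.+1, 2) + k.

Definition block_next (p : nat * nat) : nat * nat :=
  if (p.2 < p.1)%N then (p.1, p.2.+1) else (p.1.+1, 0%N).

Definition block_index (N : nat) : nat * nat := iter N block_next (0%N, 0%N).

Lemma block_posK (n k : nat) : (k <= n)%N ->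
  block_index (block_pos n k) = (n, k).
Proof.
rewrite /block_index /block_pos.
elim: n k => [|n IHn] k.
  by rewrite leqn0 => /eqP ->.
elim: k => [_|k IHk lt_kn].
  by rewrite addn0 binS bin1 addnS /= IHn // /block_next /= ltnn.
by rewrite addnS /= IHk 1?ltnW // /block_next /= lt_kn.
Qed.

Definition block (R : Type) (A : infmatrix R) (i j : nat) :
    'M[R]_(i.+1, j.+1) :=
  \matrix_(p < i.+1, q < j.+1) A (block_pos i p) (block_pos j q).

Definition block_bandwidths (R : realType) (s u : nat)
    (A : infmatrix R) : Prop :=
  forall i j : nat, (s < i - j)%N \/ (u < j - i)%N -> block A i j = 0.

Definition integrable_weight (R : realType) (l r : R) (w : R -> R) : Prop :=
  (@lebesgue_measure R).-integrable `[l, r] (EFin \o w).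

Definition orthonormal_polys (R : realType) (l r : R) (w : R -> R)
    (p : nat -> {poly R}) : Prop :=
  (forall n, size (p n) = n.+1 /\ 0 < lead_coef (p n)) /\
  (forall m n, (\int[@lebesgue_measure R]_(x in `[l, r])
     ((p m).[x] * (p n).[x] * w x)%:E = ((m == n)%:R)%:E)%E).

Definition jacobi_matrix (R : realType) (l r : R) (p : nat -> {poly R})
    (J : infmatrix R) : Prop :=
  mul_matrix `[l, r] id (fun n x => (p n).[x]) J.

Definition weightR (R : realType) (alpha beta : R) (rho : R -> R)
    (a b s : R) : R -> R :=
  fun x => (beta - x) `^ a * (x - alpha) `^ b * rho x `^ s.

Definition weightP (R : realType) (gamma delta d c : R) : R -> R :=
  fun y => (delta - y) `^ d * (y - gamma) `^ c.

Definition weightW (R : realType) (alpha beta gamma delta : R) (rho : R -> R)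
    (a b c d : R) : R * R -> R :=
  fun z => (beta - z.1) `^ a * (z.1 - alpha) `^ b *
    (z.2 - gamma * rho z.1) `^ c * (delta * rho z.1 - z.2) `^ d.

Definition Omega (R : realType) (alpha beta gamma delta : R) (rho : R -> R) :
    set (R * R) :=
  [set z | alpha <= z.1 <= beta /\
           gamma * rho z.1 <= z.2 <= delta * rho z.1].

(* RP s n stands for R_n^(a,b,s) and P for the polynomials in y. Where
   rho x = 0, a point (x, y) of Omega has y = 0, so that y / 0 = 0 gives
   rho(x)^k P_k(y / rho(x)) the value of its continuous extension. *)
Definition koornwinder (R : realType) (rho : R -> R) (c d : R)
    (RP : R -> nat -> {poly R}) (P : nat -> {poly R}) (n k : nat) :
    R * R -> R :=
  fun z => (RP (c + d + k.*2%:R + 1) (n - k)%N).[z.1] * rho z.1 ^+ k *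
    (P k).[z.2 / rho z.1].

Definition koornwinder_row (R : realType) (rho : R -> R) (c d : R)
    (RP : R -> nat -> {poly R}) (P : nat -> {poly R}) (N : nat) :
    R * R -> R :=
  koornwinder rho c d RP P (block_index N).1 (block_index N).2.

(* Main.v *)
Require Import Defs.
From HB Require Import structures.
From mathcomp Require Import all_boot all_order all_algebra.
From mathcomp Require Import all_classical all_reals all_analysis.
From mathcomp Require Import ring.

Set Implicit Arguments.
Unset Strict Implicit.
Unset Printing Implicit Defensive.

Import Order.TTheory GRing.Theory Num.Theory.
Import numFieldNormedType.Exports.

Local Open Scope classical_set_scope.
Local Open Scope ring_scope.

(** For fixed k, the polynomials H_(n,k), n >= k, are the orthonormal
polynomials R_0, R_1, ... of the single parameter s_k = c + d + 2k + 1, all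
multiplied by the common factor rho(x)^k P_k(y / rho(x)). Multiplication by x
acts on the R factor only, so the recurrence of R becomes that of H, with the
index shifted by k ([koornwinder_mulx]). The matrix of multiplication by x is
thus the direct sum over k of the Jacobi matrices J(s_k), each placed at the
positions (n, k), n >= k ([direct_sum_matrix]): it never couples different k,
which makes the blocks diagonal, and it inherits symmetry and the
(block) tridiagonal shape from the summands.

It remains to know that a Jacobi matrix, given only through
x R = R J on the interval, is symmetric and tridiagonal. Pointwise identities
on an interval are polynomial identities, so pairing x p_j with p_i against the
weight shows that J_(i,j) is the integral of x p_i p_j w, which is symmetric in
i and j ([jacobi_entry], [jacobi_sym]). A degree count gives J_(i,j) = 0 for
i > j + 1, and symmetry gives the other half ([jacobi_tridiagonal]).

Uniqueness of the matrix is the linear independence of the H_(n,k) on Omega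
([koornwinder_free]). With y = t rho(x), a vanishing combination is for each x
a polynomial in t, expanded in the P_k; its coefficients vanish, and after
division by rho(x)^k > 0 they are polynomials in x expanded in the R_i. *)

(** * Polynomial identities and graded families *)

Lemma poly_eq0_on_itv (R : realType) (l r : R) (p : {poly R}) : l < r ->
  (forall x, l < x < r -> p.[x] = 0) -> p = 0.
Proof.
move=> lr p0; pose t (i : nat) : R := l + (r - l) / i.+2%:R.
have rl0 : 0 < r - l by rewrite subr_gt0.
apply: (@roots_geq_poly_eq0 _ p (mkseq t (size p))).
- apply/allP => _ /mapP[i _ ->]; apply/eqP/p0; rewrite /t.
  rewrite ltrDl divr_gt0 ?ltr0n //= -ltrBrDl ltr_pdivrMr ?ltr0n //.
  by rewrite ltr_pMr // ltr1n.
- rewrite map_inj_uniq ?iota_uniq // => i j /addrI.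
  move=> /(mulfI (lt0r_neq0 rl0)) /invr_inj /eqP.
  by rewrite eqr_nat => /eqP[].
- by rewrite size_mkseq.
Qed.

(** The top coefficient of the sum only involves the last polynomial, so the
coefficients can be peeled off from the top. For M = 0 this is linear
independence; for larger M it bounds the length of an expansion by the size of
its value. *)
Lemma graded_coef_eq0 (R : idomainType) (p : nat -> {poly R})
    (hp : forall n, size (p n) = n.+1) (e : nat -> R) (M N : nat) :
  (size (\sum_(i < N) e i *: p i)%R <= M)%N ->
  forall i, (M <= i < N)%N -> e i = 0.
Proof.
elim: N => [|N IHN] hs i /andP[Mi]; first by rewrite ltn0.
have [MN|NM] := leqP M N; last by rewrite ltnS leqNgt (leq_trans NM Mi).
have eN : e N = 0.
  have : (\sum_(i < N.+1) e i *: p i)`_N = 0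
    by rewrite nth_default ?(leq_trans hs).
  rewrite big_ord_recr /= coefD coefZ nth_default ?add0r; last first.
    apply: (leq_trans (size_sum _ _ _)); apply/bigmax_leqP => k _.
    by rewrite (leq_trans (size_scale_leq _ _)) // hp.
  move=> /eqP; rewrite mulf_eq0 => /orP[/eqP //|].
  have -> : (p N)`_N = lead_coef (p N) by rewrite lead_coefE hp.
  by rewrite lead_coef_eq0 -size_poly_eq0 hp.
move: hs; rewrite big_ord_recr /= eN scale0r addr0 => hs.
rewrite ltnS leq_eqVlt => /orP[/eqP -> //|iN].
by apply: IHN; rewrite ?Mi.
Qed.

(** The products with infinite matrices come with an unspecified truncation
point; this allows any two of them to be exchanged. *)
Lemma sum_ord_support (V : nmodType) (F : nat -> V) (M N : nat) :
  (forall i, (M <= i)%N -> F i = 0) -> (forall i, (N <= i)%N -> F i = 0) ->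
  \sum_(i < M) F i = \sum_(i < N) F i.
Proof.
wlog MN : M N / (M <= N)%N.
  by move=> H FM FN; case: (leqP M N) => [|/ltnW] MN; [|symmetry]; apply: H.
move=> FM _; rewrite (big_ord_widen N F MN) big_mkcond /=.
by apply: eq_bigr => i _; case: ltnP => // /FM.
Qed.

(** * Jacobi matrices of orthonormal polynomials *)

(** A polynomial is bounded on the compact segment, which preserves
integrability of the weight; linearity of [moment] rests on this. *)
Lemma integrable_poly_weight (R : realType) (l r : R) (w : R -> R)
    (p : {poly R}) : integrable_weight l r w ->
  (@lebesgue_measure R).-integrable `[l, r] (EFin \o (fun x => p.[x] * w x)).
Proof.
move=> iw.
have -> : EFin \o (fun x => p.[x] * w x) =
    ((EFin \o horner p) \* (EFin \o w))%E.
  by apply/funext => x /=; rewrite EFinM.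
apply: integrableMr => //; first exact: measurable_poly.
have /compact_bounded : compact (horner p @` `[l, r]).
  apply: continuous_compact; last exact: segment_compact.
  by apply: continuous_subspaceT; exact: continuous_horner.
move=> [M [Mr HM]]; exists M; split => // y My x /= xlr.
by apply: (HM y My); exists x.
Qed.

Definition moment (R : realType) (l r : R) (w : R -> R) (p : {poly R}) : R :=
  \int[@lebesgue_measure R]_(x in `[l, r]) (p.[x] * w x).

Lemma moment_sum (R : realType) (l r : R) (w : R -> R) (N : nat)
    (e : nat -> R) (p : nat -> {poly R}) : integrable_weight l r w ->
  moment l r w (\sum_(i < N) e i *: p i) =
  \sum_(i < N) e i * moment l r w (p i).
Proof.
move=> iw; elim: N => [|N IHN].
  rewrite !big_ord0 /moment.
  under eq_Rintegral do rewrite horner0 mul0r.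
  by rewrite Rintegral_cst // mul0r.
rewrite !big_ord_recr /= -IHN /moment.
under eq_Rintegral do rewrite hornerD mulrDl.
rewrite RintegralD //; try exact: integrable_poly_weight.
congr (_ + _).
under eq_Rintegral do rewrite hornerZ -mulrA.
by rewrite RintegralZl //; exact: integrable_poly_weight.
Qed.

Lemma moment_orthonormal (R : realType) (l r : R) (w : R -> R)
    (p : nat -> {poly R}) (m n : nat) : orthonormal_polys l r w p ->
  moment l r w (p m * p n) = (m == n)%:R.
Proof.
move=> [_ /(_ m n) op]; rewrite /moment /Rintegral.
by under eq_integral do rewrite hornerM; rewrite op.
Qed.

(** The relation defining a Jacobi matrix holds on a segment, hence as an
identity of polynomials; degrees can then be compared. *)
Lemma jacobi_poly (R : realType) (l r : R) (p : nat -> {poly R})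
    (J : infmatrix R) (j : nat) : l < r -> jacobi_matrix l r p J ->
  exists2 N, (forall i, (N <= i)%N -> J i j = 0) &
    'X * p j = \sum_(i < N) J i j *: p i.
Proof.
move=> lr /(_ j)[N [J0 HJ]]; exists N => //; apply/eqP; rewrite -subr_eq0.
apply/eqP/(poly_eq0_on_itv lr) => x /andP[lx xr].
have /HJ /= : `[l, r]%classic x by rewrite /= in_itv /= !ltW.
rewrite !hornerE horner_sum => ->; rewrite -sumrB big1 // => i _.
by rewrite hornerZ mulrC subrr.
Qed.

(** Fourier coefficient of x p_j along p_i: expand x p_j by the columns of J
and use orthonormality. Beyond the truncation point both sides are 0. *)
Lemma jacobi_entry (R : realType) (l r : R) (w : R -> R)
    (p : nat -> {poly R}) (J : infmatrix R) (i j : nat) : l < r ->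
  integrable_weight l r w -> orthonormal_polys l r w p ->
  jacobi_matrix l r p J -> J i j = moment l r w ('X * p j * p i).
Proof.
move=> lr iw op /(jacobi_poly j lr)[N J0 ->]; rewrite mulr_suml.
under eq_bigr do rewrite -scalerAl.
rewrite (moment_sum N (fun k => J k j) (fun k => p k * p i) iw).
under eq_bigr do rewrite (moment_orthonormal _ _ op) mulr_natr mulrb.
have [iN|/J0 Jij] := ltnP i N.
  by rewrite -big_mkcond /= (big_pred1 (Ordinal iN)).
by rewrite Jij big1 // => k _; case: eqP => // ->.
Qed.

Lemma jacobi_sym (R : realType) (l r : R) (w : R -> R)
    (p : nat -> {poly R}) (J : infmatrix R) : l < r ->
  integrable_weight l r w -> orthonormal_polys l r w p ->
  jacobi_matrix l r p J -> symmetric_matrix J.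
Proof.
move=> lr iw op jJ i j; rewrite !(jacobi_entry _ _ lr iw op jJ).
by rewrite -!mulrA [p i * _]mulrC.
Qed.

(** x p_j has degree j + 1, so p_i with i > j + 1 cannot occur in it. *)
Lemma jacobi_lower (R : realType) (l r : R) (p : nat -> {poly R})
    (J : infmatrix R) (i j : nat) : l < r ->
  (forall n, size (p n) = n.+1) -> jacobi_matrix l r p J ->
  (j.+1 < i)%N -> J i j = 0.
Proof.
move=> lr hp /(jacobi_poly j lr)[N J0 Xp] ji.
have [iN|/J0 //] := ltnP i N.
apply: (graded_coef_eq0 hp (M := j.+2) (e := J^~ j) (N := N));
  last by rewrite ji.
by rewrite -Xp mulrC size_mulX -?size_poly_eq0 hp.
Qed.

Definition tridiagonal_matrix (R : realType) (A : infmatrix R) : Prop :=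
  forall i j, (j.+1 < i)%N || (i.+1 < j)%N -> A i j = 0.

Lemma tridiagonal_shift (R : realType) (A : infmatrix R) (k m n : nat) :
  tridiagonal_matrix A -> (k <= m)%N -> (k <= n)%N ->
  (n.+1 < m)%N || (m.+1 < n)%N -> A (m - k)%N (n - k)%N = 0.
Proof.
move=> tA km kn mn; apply: tA.
by rewrite -(subSn kn) -(subSn km) !ltn_sub2rE ?leqW.
Qed.

Lemma jacobi_tridiagonal (R : realType) (l r : R) (w : R -> R)
    (p : nat -> {poly R}) (J : infmatrix R) : l < r ->
  integrable_weight l r w -> orthonormal_polys l r w p ->
  jacobi_matrix l r p J -> tridiagonal_matrix J.
Proof.
move=> lr iw op jJ i j; have hp n : size (p n) = n.+1 by have [/(_ n)[]] := op.
case/orP => [/(jacobi_lower lr hp jJ) //|/(jacobi_lower lr hp jJ) <-].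
exact: jacobi_sym lr iw op jJ i j.
Qed.

Lemma jacobi_recurrence (R : realType) (l r : R) (p : nat -> {poly R})
    (J : infmatrix R) (j M : nat) (x : R) : l < r ->
  (forall n, size (p n) = n.+1) -> jacobi_matrix l r p J ->
  (j.+2 <= M)%N ->
  x * (p j).[x] = \sum_(i < M) J i j * (p i).[x].
Proof.
move=> lr hp jJ jM; have [N J0 /(congr1 (horner^~ x))] := jacobi_poly j lr jJ.
rewrite hornerM hornerX horner_sum => ->.
under eq_bigr do rewrite hornerZ.
apply: (sum_ord_support (F := fun i => J i j * (p i).[x])) => i hi.
  by rewrite J0 // mul0r.
by rewrite (jacobi_lower lr hp jJ) ?mul0r // (leq_trans jM).
Qed.

(** * Block ordering *)

Lemma sum_shift (V : nmodType) (F : nat -> V) (k M : nat) :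
  \sum_(m < M | (k <= m)%N) F m = \sum_(i < M - k) F (i + k)%N.
Proof.
rewrite -(big_mkord (fun m => (k <= m)%N) F) -(big_nat_widenl _ _ _ xpredT) //.
by rewrite -[X in \sum_(X <= _ < _) _]add0n big_addn big_mkord.
Qed.

Lemma sum_blocks (V : nmodType) (F : nat -> V) (M : nat) :
  \sum_(i < 'C(M.+1, 2)) F i =
  \sum_(m < M) \sum_(k < m.+1) F (block_pos m k).
Proof.
elim: M => [|M IHM]; first by rewrite !big_ord0.
by rewrite [RHS]big_ord_recr /= -IHM binS bin1 big_split_ord.
Qed.

Lemma block_indexK (N : nat) :
  ((block_index N).2 <= (block_index N).1)%N /\
  block_pos (block_index N).1 (block_index N).2 = N.
Proof.
elim: N => [//|N []]; rewrite /block_index iterS -/(block_index N) /block_next.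
case: (block_index N) => n k /= kn; rewrite /block_pos.
case: ltnP => [lt_kn|nk] /= <-; first by rewrite addnS.
by split=> //; rewrite (anti_leq (_ : (k <= n <= k)%N)) ?kn //
  addn0 binS bin1 addnS.
Qed.

Lemma block_pos_lt (n k M : nat) : (k <= n)%N ->
  (block_pos n k < 'C(M.+1, 2))%N = (n < M)%N.
Proof.
move=> kn; apply/idP/idP => [|nM].
  apply: contraLR; rewrite -!leqNgt => Mn.
  by apply: leq_trans (leq_addr _ _); apply: leq_bin2l.
apply: (@leq_trans 'C(n.+2, 2)); last by apply: leq_bin2l.
by rewrite /block_pos [X in (_ < X)%N]binS bin1 ltn_add2l.
Qed.

Lemma leq_block_size (M : nat) : (M <= 'C(M.+1, 2))%N.
Proof. by rewrite binS bin1 leq_addl. Qed.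

(** * Multiplication by x and linear independence *)

(** The factor rho(x)^k P_k(y / rho(x)) is common to all terms, so this is the
recurrence of the R_i with i = m - k. *)
Lemma koornwinder_mulx (R : realType) (l r : R) (rho : R -> R) (c d : R)
    (RP : R -> nat -> {poly R}) (P : nat -> {poly R}) (J : infmatrix R)
    (n k M : nat) (z : R * R) : l < r ->
  (forall i, size (RP (c + d + k.*2%:R + 1) i) = i.+1) ->
  jacobi_matrix l r (RP (c + d + k.*2%:R + 1)) J ->
  (k <= n)%N -> (n.+2 <= M)%N ->
  z.1 * koornwinder rho c d RP P n k z =
  \sum_(m < M | (k <= m)%N) J (m - k)%N (n - k)%N *
     koornwinder rho c d RP P m k z.
Proof.
move=> lr hp jJ kn nM; rewrite (sum_shift (fun m => J (m - k)%N (n - k)%N *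
  koornwinder rho c d RP P m k z)).
have nkM : ((n - k).+2 <= M - k)%N by rewrite -!subSn ?leq_sub2r // leqW.
rewrite /koornwinder !mulrA (jacobi_recurrence _ lr hp jJ nkM) !mulr_suml.
by apply: eq_bigr => i _; rewrite addnK !mulrA.
Qed.

(** On the curve y = t rho(x) the two variables separate: independence of the
P_k in t isolates one value of k, independence of the R_i in x finishes. Only
interior x matter, where rho does not vanish. *)
Lemma koornwinder_free (R : realType) (alpha beta gamma delta : R)
    (rho : R -> R) (c d : R) (RP : R -> nat -> {poly R})
    (P : nat -> {poly R}) (e : nat -> nat -> R) (M : nat) :
  alpha < beta -> gamma < delta ->
  (forall x, alpha < x < beta -> 0 < rho x) ->
  (forall k i, size (RP (c + d + k.*2%:R + 1) i) = i.+1) ->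
  (forall i, size (P i) = i.+1) ->
  (forall z, Omega alpha beta gamma delta rho z ->
     \sum_(m < M) \sum_(k < m.+1) e m k * koornwinder rho c d RP P m k z = 0) ->
  forall m k, (k <= m < M)%N -> e m k = 0.
Proof.
move=> ab gd rho0 hRP hP e0 m k /andP[km mM].
(* E k is the coefficient of rho(x)^k P_k(t), a polynomial in x. *)
pose E k := \sum_(m < M | (k <= m)%N)
  e m k *: RP (c + d + k.*2%:R + 1) (m - k)%N.
suff : E k = 0.
  rewrite /E (sum_shift (fun m => e m k *: RP _ (m - k)%N)).
  under eq_bigr do rewrite addnK.
  move=> Ek; rewrite -(subnK km).
  apply: (graded_coef_eq0 (hRP k) (e := fun i => e (i + k)%N k)
    (M := 0) (N := (M - k)%N)); last by rewrite ltn_sub2r // (leq_ltn_trans km).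
  by rewrite Ek size_poly0.
apply: (poly_eq0_on_itv ab) => x xab.
have rx := rho0 x xab.
suff /eqP : rho x ^+ k * (E k).[x] = 0.
  by rewrite mulf_eq0 expf_eq0 (gt_eqF rx) andbF /= => /eqP.
apply: (graded_coef_eq0 hP (e := fun k => rho x ^+ k * (E k).[x])
  (M := 0) (N := M)); last exact: leq_ltn_trans mM.
rewrite leqn0 size_poly_eq0; apply/eqP/(poly_eq0_on_itv gd) => t /andP[gt td].
have /e0 : Omega alpha beta gamma delta rho (x, t * rho x).
  by case/andP: xab => *; rewrite /Omega /= !ler_pM2r // !ltW.
rewrite horner_sum => s0; rewrite -[RHS]s0.
(* Widen the inner sums to a common range, to exchange the summations. *)
under [RHS]eq_bigr => i _.
  rewrite (big_ord_widen M
    (fun k => e i k * koornwinder rho c d RP P i k _)) //.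
  over.
rewrite [RHS](exchange_big_dep xpredT) //=; apply: eq_bigr => j _.
rewrite hornerZ /E horner_sum mulr_sumr mulr_suml.
apply: eq_big => [i|i _]; first by rewrite ltnS.
by rewrite /koornwinder /= mulfK ?gt_eqF // hornerZ; ring.
Qed.

Lemma row_koornwinder (R : realType) (rho : R -> R) (c d : R)
    (RP : R -> nat -> {poly R}) (P : nat -> {poly R}) (n k : nat) :
  (k <= n)%N -> koornwinder_row rho c d RP P (block_pos n k) =
    koornwinder rho c d RP P n k.
Proof. by move=> kn; rewrite /koornwinder_row block_posK. Qed.

(** * Direct sums of matrices along the block ordering *)

(** The k-th summand acts on the span of the basis vectors at the positions
(k, k), (k + 1, k), (k + 2, k), ..., numbered 0, 1, 2, ... by n - k. *)
Definition direct_sum_matrix (R : realType) (J : nat -> infmatrix R) :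
    infmatrix R :=
  fun i j => let: (m, k') := block_index i in let: (n, k) := block_index j in
    if k' == k then J k (m - k)%N (n - k)%N else 0.

Lemma direct_sum_matrixE (R : realType) (J : nat -> infmatrix R)
    (m k' n k : nat) : (k' <= m)%N -> (k <= n)%N ->
  direct_sum_matrix J (block_pos m k') (block_pos n k) =
  if k' == k then J k (m - k)%N (n - k)%N else 0.
Proof. by move=> k'm kn; rewrite /direct_sum_matrix !block_posK. Qed.

Lemma direct_sum_matrix_sym (R : realType) (J : nat -> infmatrix R) :
  (forall k, symmetric_matrix (J k)) -> symmetric_matrix (direct_sum_matrix J).
Proof.
move=> Jsym i j; rewrite /direct_sum_matrix.
case: (block_index i) (block_index j) => [m k'] [n k].
by rewrite eq_sym; case: eqP => // ->; apply: Jsym.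
Qed.

Lemma direct_sum_matrix_tridiagonal (R : realType) (J : nat -> infmatrix R) :
  (forall k, tridiagonal_matrix (J k)) ->
  block_bandwidths 1 1 (direct_sum_matrix J).
Proof.
move=> Jtri i j ij; apply/matrixP => p q.
rewrite [LHS]mxE [RHS]mxE direct_sum_matrixE ?leq_ord //; case: eqP => // pq.
apply: tridiagonal_shift; rewrite ?leq_ord -?pq ?leq_ord //.
by apply/orP; case: ij; rewrite ltn_subRL addn1; [left|right].
Qed.

Lemma direct_sum_matrix_diagonal (R : realType) (J : nat -> infmatrix R)
    (i j : nat) : bandwidths 0 0 (block (direct_sum_matrix J) i j).
Proof.
move=> p q; rewrite !subn_gt0 => pq; rewrite mxE direct_sum_matrixE ?leq_ord //.
by case: eqP pq => // ->; rewrite !ltnn => -[].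
Qed.

(** * The matrix of multiplication by x *)

(** Only m <= n + 1 contribute to the column at (n, k), so the first n + 2
blocks suffice, and in block m only the position with the same k survives. *)
Lemma koornwinder_row_mulx (R : realType) (l r gamma delta : R) (rho : R -> R)
    (c d : R) (RP : R -> nat -> {poly R}) (P : nat -> {poly R})
    (J : nat -> infmatrix R) : l < r ->
  (forall k i, size (RP (c + d + k.*2%:R + 1) i) = i.+1) ->
  (forall k, jacobi_matrix l r (RP (c + d + k.*2%:R + 1)) (J k)) ->
  (forall k, tridiagonal_matrix (J k)) ->
  mul_matrix (Omega l r gamma delta rho) fst (koornwinder_row rho c d RP P)
    (direct_sum_matrix J).
Proof.
move=> lr szR jJ Jtri j; have [] := block_indexK j.
set n := (block_index j).1; set k := (block_index j).2 => kn <-.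
exists 'C(n.+3, 2); split=> [i|z _].
  have [] := block_indexK i.
  set m := (block_index i).1; set k' := (block_index i).2 => km <-.
  rewrite leqNgt block_pos_lt // -leqNgt => nm.
  rewrite direct_sum_matrixE //; case: eqP => // kk.
  by rewrite tridiagonal_shift // -?kk ?nm.
rewrite row_koornwinder //.
rewrite (koornwinder_mulx rho P z lr (szR k) (jJ k) kn (leqnn _)).
rewrite (sum_blocks (fun i => koornwinder_row rho c d RP P i z *
  direct_sum_matrix _ i _)).
rewrite big_mkcond /=; apply: eq_bigr => m _.
under [RHS]eq_bigr => i _
  do rewrite row_koornwinder ?leq_ord // direct_sum_matrixE ?leq_ord //.
case: leqP => [km|mk].
  rewrite (bigD1 (Ordinal (km : (k < m.+1)%N))) //= eqxx big1 ?addr0 1?mulrC //.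
  by move=> i; rewrite -val_eqE /= => /negPf ->; rewrite mulr0.
rewrite big1 // => i _; case: eqP => [ik|_]; last by rewrite mulr0.
by have := ltn_ord i; rewrite ik ltnS leqNgt mk.
Qed.

(** Whatever the multiplier f, the difference of corresponding columns of A and
B is the coefficient vector of a vanishing combination of the H_(n,k). *)
Lemma koornwinder_row_mul_inj (R : realType) (alpha beta gamma delta : R)
    (rho : R -> R) (c d : R) (RP : R -> nat -> {poly R})
    (P : nat -> {poly R}) (f : R * R -> R) (A B : infmatrix R) :
  alpha < beta -> gamma < delta ->
  (forall x, alpha < x < beta -> 0 < rho x) ->
  (forall k i, size (RP (c + d + k.*2%:R + 1) i) = i.+1) ->
  (forall i, size (P i) = i.+1) ->
  mul_matrix (Omega alpha beta gamma delta rho) f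
    (koornwinder_row rho c d RP P) A ->
  mul_matrix (Omega alpha beta gamma delta rho) f
    (koornwinder_row rho c d RP P) B -> A = B.
Proof.
move=> ab gd rho0 szR szP mA mB; apply/funext => i; apply/funext => j.
have [NA [A0 AN]] := mA j; have [NB [B0 BN]] := mB j.
have [ki iE] := block_indexK i.
(* M complete blocks contain row i and both truncation points. *)
pose M := maxn (block_index i).1.+1 (maxn NA NB).
have rowM (C : infmatrix R) (N : nat) z : (N <= M)%N ->
    (forall i, (N <= i)%N -> C i j = 0) ->
    \sum_(i < N) koornwinder_row rho c d RP P i z * C i j =
    \sum_(i < 'C(M.+1, 2)) koornwinder_row rho c d RP P i z * C i j.
  move=> NM C0; apply: (sum_ord_support
    (F := fun i => koornwinder_row rho c d RP P i z * C i j)) => l hl.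
    by rewrite C0 ?mulr0.
  by rewrite C0 ?mulr0 // (leq_trans NM) // (leq_trans (leq_block_size M)).
apply/eqP; rewrite -subr_eq0 -iE; apply/eqP.
apply: (koornwinder_free (M := M)
  (e := fun m k => A (block_pos m k) j - B (block_pos m k) j)
  ab gd rho0 szR szP) => [z Oz|]; last by rewrite ki leq_max leqnn.
under eq_bigr => m _
  do under eq_bigr => k _ do rewrite -row_koornwinder ?leq_ord // mulrC mulrBr.
rewrite -(sum_blocks (fun i => koornwinder_row rho c d RP P i z * A i j -
  koornwinder_row rho c d RP P i z * B i j)).
rewrite sumrB -(rowM A NA) ?leq_max ?leqnn ?orbT //.
by rewrite -(rowM B NB) ?leq_max ?leqnn ?orbT // -AN // -BN // subrr.
Qed.

(* eta = false is case (i), eta = true is case (ii); q is rho ^ (1 + eta). *)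
Theorem proposition5p1 (R : realType) (alpha beta gamma delta : R)
  (hab : alpha < beta) (hgd : gamma < delta)
  (rho : R -> R)
  (hrho : forall x, alpha < x < beta -> 0 < rho x)
  (eta : bool) (q : {poly R})
  (hq : forall x, alpha <= x <= beta ->
          rho x = if eta then Num.sqrt q.[x] else q.[x])
  (hdeg : (2 + eta <= (size q).-1)%N)
  (hii1 : eta -> delta = - gamma /\ 0 < delta)
  (a b c d : R)
  (ha : -1 < a) (hb : -1 < b) (hc : -1 < c) (hd : -1 < d)
  (hii2 : eta -> c = d)
  (hwR : forall k : nat, integrable_weight alpha beta
           (weightR alpha beta rho a b (c + d + k.*2%:R + 1)))
  (hwP : integrable_weight gamma delta (weightP gamma delta d c))
  (hW : ((@lebesgue_measure R) \x (@lebesgue_measure R))%E.-integrable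
           (Omega alpha beta gamma delta rho)
           (EFin \o weightW alpha beta gamma delta rho a b c d))
  (RP : R -> nat -> {poly R})
  (hRP : forall s : R,
           integrable_weight alpha beta (weightR alpha beta rho a b s) ->
           orthonormal_polys alpha beta (weightR alpha beta rho a b s) (RP s))
  (P : nat -> {poly R})
  (hP : orthonormal_polys gamma delta (weightP gamma delta d c) P)
  (J : R -> infmatrix R)
  (hJ : forall s : R,
          integrable_weight alpha beta (weightR alpha beta rho a b s) ->
          jacobi_matrix alpha beta (RP s) (J s)) :
  (forall n k : nat, (k <= n)%N ->
     forall z : R * R, Omega alpha beta gamma delta rho z ->
       z.1 * koornwinder rho c d RP P n k z =
       \sum_(n.-1 <= m < n.+2 | (k <= m)%N)
         J (c + d + k.*2%:R + 1) (n - k)%N (m - k)%N *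
         koornwinder rho c d RP P m k z)
  /\
  (exists Jx : infmatrix R,
     unique (mul_matrix (Omega alpha beta gamma delta rho) fst
               (koornwinder_row rho c d RP P)) Jx /\
     symmetric_matrix Jx /\
     block_bandwidths 1 1 Jx /\
     (forall i j : nat, bandwidths 0 0 (block Jx i j))).
Proof.
set s := fun k : nat => c + d + k.*2%:R + 1.
have op k : orthonormal_polys alpha beta _ (RP (s k)) := hRP _ (hwR k).
have jJ k : jacobi_matrix alpha beta (RP (s k)) (J (s k)) := hJ _ (hwR k).
have szR k i : size (RP (s k) i) = i.+1 by have [/(_ i)[]] := op k.
have szP i : size (P i) = i.+1 by have [/(_ i)[]] := hP.
have Jsym k := jacobi_sym hab (hwR k) (op k) (jJ k).
have Jtri k := jacobi_tridiagonal hab (hwR k) (op k) (jJ k).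
split.
  move=> n k kn z _.
  rewrite (koornwinder_mulx rho P z hab (szR k) (jJ k) kn (leqnn _)).
  rewrite (big_nat_widenl _ 0) // big_mkord big_mkcond [RHS]big_mkcond /=.
  apply: eq_bigr => m _; case: (leqP k m) => //= km; case: leqP => [_|].
    by rewrite -/(s k) (Jsym k).
  (* m < n - 1 is outside the band, and is absent from the sum on the right. *)
  rewrite ltn_predRL => mn.
  by rewrite (tridiagonal_shift (Jtri k)) ?mul0r ?mn ?orbT.
have Jxmul := koornwinder_row_mulx (J := fun k => J (s k))
  gamma delta rho P hab szR jJ Jtri.
exists (direct_sum_matrix (fun k => J (s k))); split; [|split; [|split]].
- by split=> // A; apply: koornwinder_row_mul_inj Jxmul.
- exact: direct_sum_matrix_sym.
- exact: direct_sum_matrix_tridiagonal.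
- exact: direct_sum_matrix_diagonal.
Qed.
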